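(* Let $0<q<p\le\infty$ with $q\le 2$. Then for every integer $n\ge 1$ and every $f\in\mathcal{T}_n$, $$\|f\|_{L_p[0,1]} \le \left(\frac{\pi n}{2}\right)^{2/q-2/p}\|f\|_{L_q[0,1]}.$$
   Context: For an integer $n\ge1$, $\mathcal{T}_n$ denotes the set of all functions $f:\mathbb{R}\to\mathbb{C}$ of the form $f(t)=\sum_{j=1}^n a_j e^{i\lambda_j t}$ with $a_j\in\mathbb{C}$ (possibly zero) and real exponents $\lambda_1<\lambda_2<\cdots<\lambda_n$. For $0<r<\infty$, $\|f\|_{L_r[0,1]}:=(\int_0^1|f(t)|^r\,dt)^{1/r}$, and $\|f\|_{L_\infty[0,1]}:=\sup_{t\in[0,1]}|f(t)|$. *)

(* Defs.v *)
From Stdlib Require Import Reals Lra ClassicalEpsilon.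
Open Scope R_scope.

Definition Cx := (R * R)%type.

Fixpoint sumR (n : nat) (g : nat -> R) : R :=
  match n with O => 0 | S k => sumR k g + g k end.

(* f(t) = sum_{j<n} a_j e^{i lam_j t}; real and imaginary parts. *)
Definition tp_re (n : nat) (a : nat -> Cx) (lam : nat -> R) (t : R) : R :=
  sumR n (fun j => fst (a j) * cos (lam j * t) - snd (a j) * sin (lam j * t)).
Definition tp_im (n : nat) (a : nat -> Cx) (lam : nat -> R) (t : R) : R :=
  sumR n (fun j => fst (a j) * sin (lam j * t) + snd (a j) * cos (lam j * t)).
Definition tp_abs (n : nat) (a : nat -> Cx) (lam : nat -> R) (t : R) : R :=
  sqrt (tp_re n a lam t ^ 2 + tp_im n a lam t ^ 2).

Definition strictly_increasing_upto (n : nat) (lam : nat -> R) : Prop :=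
  forall j k, (j < k)%nat -> (k < n)%nat -> lam j < lam k.

(* x^y for x >= 0, y > 0, with 0^y = 0 *)
Definition rpow (x y : R) : R := if Rle_dec x 0 then 0 else Rpower x y.

(* Riemann integral over [0,1] (the integrands used here are continuous,
   hence Riemann integrable; value 0 is a junk default otherwise). *)
Definition integral01 (g : R -> R) : R :=
  match excluded_middle_informative (inhabited (Riemann_integrable g 0 1)) with
  | left H => RiemannInt (epsilon H (fun _ => True))
  | right _ => 0
  end.

Definition sup01 (g : R -> R) : R :=
  epsilon (inhabits 0)
    (fun M => is_lub (fun y => exists t, 0 <= t <= 1 /\ y = g t) M).

Inductive exponent := Fin (r : R) | Infty.

(* L_r[0,1] norm of a function given by its modulus g = |f| *)
Definition Lnorm (e : exponent) (g : R -> R) : R :=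
  match e with
  | Fin r => rpow (integral01 (fun t => rpow (g t) r)) (1 / r)
  | Infty => sup01 g
  end.

Definition inv_exp (e : exponent) : R :=
  match e with Fin r => 1 / r | Infty => 0 end.

Definition exp_gt (p : exponent) (q : R) : Prop :=
  match p with Fin r => q < r | Infty => True end.

(* Main.v *)
(* By interpolation between L_q and L_infinity it suffices to show that
   |f(x)| <= (pi n / 2) ||f||_2 on [0,1]; splitting [0,1] at x, reflecting and
   dilating, it suffices to take x = 1.  Put M = n N, z_j = exp (i lam_j / M).  A
   cascade of M sections of a lossless lattice filter, N sections of angle
   phi = pi / (2 N) per node with the second channel reset between nodes, gives
   coefficients s_0, ..., s_M with sum |s_k|^2 <= 1, |s_M| = cos(phi)^M and
   sum_k s_k z_j^k = 0 for all j: at z_j the N rotations of its block add up to a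
   quarter turn.  Hence sum_k s_k f(k/M) = 0, and Cauchy-Schwarz bounds
   cos(phi)^(2M) |f(1)|^2 by (1 - cos(phi)^(2M)) sum_{k<M} |f(k/M)|^2.  Since
   M phi^2 = n pi^2 / (4 N), the constant becomes (pi n / 2)^2 as N grows. *)
Require Import Defs.
From Stdlib Require Import Reals Lra Lia.
From Coquelicot Require Import Coquelicot.
Open Scope R_scope.

(** * Finite real sums and the Cauchy-Schwarz inequality *)

Lemma sumR_ext (n : nat) (f g : nat -> R) :
  (forall k, (k < n)%nat -> f k = g k) -> sumR n f = sumR n g.
Proof.
  induction n as [|n IH]; intros H; simpl; [reflexivity|].
  rewrite IH, H by (auto with arith); reflexivity.
Qed.

Lemma sumR_plus (n : nat) (f g : nat -> R) :
  sumR n (fun k => f k + g k) = sumR n f + sumR n g.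
Proof. induction n as [|n IH]; simpl; [ring | rewrite IH; ring]. Qed.

Lemma sumR_shift (n : nat) (f : nat -> R) :
  sumR (S n) f = f O + sumR n (fun k => f (S k)).
Proof.
  induction n as [|n IH]; [simpl; ring|].
  change (sumR (S (S n)) f) with (sumR (S n) f + f (S n)).
  rewrite IH; simpl; ring.
Qed.

Lemma sumR_nonneg (n : nat) (f : nat -> R) :
  (forall k, 0 <= f k) -> 0 <= sumR n f.
Proof.
  intros H; induction n as [|n IH]; simpl; [lra|]. specialize (H n); lra.
Qed.

Lemma Cauchy_Schwarz_sumR (n : nat) (a b : nat -> R) :
  sumR n (fun k => a k * b k) ^ 2
    <= sumR n (fun k => a k ^ 2) * sumR n (fun k => b k ^ 2).
Proof.
  induction n as [|n IH]; [simpl; lra|].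
  cbn [sumR].
  assert (HA : 0 <= sumR n (fun k => a k ^ 2)) by (apply sumR_nonneg; intros; nra).
  assert (HB : 0 <= sumR n (fun k => b k ^ 2)) by (apply sumR_nonneg; intros; nra).
  revert IH HA HB.
  generalize (sumR n (fun k => a k * b k)) (sumR n (fun k => a k ^ 2))
    (sumR n (fun k => b k ^ 2)) (a n) (b n).
  intros P A B x y HP HA HB.
  (* Only the cross term of the expanded square remains. Its square is at most
     [4 * (A * y ^ 2) * (x ^ 2 * B)] by the induction hypothesis, and AM-GM finishes. *)
  assert (2 * P * (x * y) <= A * y ^ 2 + x ^ 2 * B); [|nra].
  assert (HAy : 0 <= A * y ^ 2) by (apply Rmult_le_pos; [assumption | apply pow2_ge_0]).
  assert (HxB : 0 <= x ^ 2 * B) by (apply Rmult_le_pos; [apply pow2_ge_0 | assumption]).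
  apply Rsqr_incr_0_var; [unfold Rsqr | lra].
  assert (P ^ 2 * (x * y) ^ 2 <= (A * B) * (x * y) ^ 2)
    by (apply Rmult_le_compat_r; [apply pow2_ge_0 | exact HP]).
  assert (0 <= (A * y ^ 2 - x ^ 2 * B) ^ 2) by apply pow2_ge_0.
  nra.
Qed.

(** * Finite complex sums *)

Fixpoint csum (n : nat) (g : nat -> C) : C :=
  match n with O => 0%C | S k => (csum k g + g k)%C end.

Lemma csum_ext (n : nat) (f g : nat -> C) :
  (forall k, (k < n)%nat -> f k = g k) -> csum n f = csum n g.
Proof.
  induction n as [|n IH]; intros H; simpl; [reflexivity|].
  rewrite IH, H by (auto with arith); reflexivity.
Qed.

Lemma csum_plus (n : nat) (f g : nat -> C) :
  csum n (fun k => f k + g k)%C = (csum n f + csum n g)%C.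
Proof. induction n as [|n IH]; simpl; [ring | rewrite IH; ring]. Qed.

Lemma csum_scal (n : nat) (c : C) (f : nat -> C) :
  csum n (fun k => c * f k)%C = (c * csum n f)%C.
Proof. induction n as [|n IH]; simpl; [ring | rewrite IH; ring]. Qed.

Lemma csum_zero (n : nat) : csum n (fun _ => 0%C) = 0%C.
Proof. induction n as [|n IH]; simpl; [ring | rewrite IH; ring]. Qed.

Lemma csum_exchange (m n : nat) (f : nat -> nat -> C) :
  csum m (fun k => csum n (fun j => f k j)) = csum n (fun j => csum m (fun k => f k j)).
Proof.
  induction m as [|m IH]; simpl; [symmetry; apply csum_zero|].
  rewrite IH, <- csum_plus; reflexivity.
Qed.

Lemma csum_shift (n : nat) (f : nat -> C) :
  csum (S n) f = (f O + csum n (fun k => f (S k)))%C.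
Proof.
  induction n as [|n IH]; [simpl; ring|].
  change (csum (S (S n)) f) with (csum (S n) f + f (S n))%C.
  rewrite IH; simpl; ring.
Qed.

Lemma Cmod_csum_le (n : nat) (f : nat -> C) :
  Cmod (csum n f) <= sumR n (fun k => Cmod (f k)).
Proof.
  induction n as [|n IH]; simpl; [rewrite Cmod_0; lra|].
  eapply Rle_trans; [apply Cmod_triangle | lra].
Qed.

Lemma Cmod_sqr (z : C) : Cmod z ^ 2 = fst z ^ 2 + snd z ^ 2.
Proof. unfold Cmod; rewrite pow2_sqrt; nra. Qed.

(** * The lossless lattice filter and the annihilating polynomial *)

Definition peval (M : nat) (s : nat -> C) (z : C) : C :=
  csum M (fun k => s k * Cpow z k)%C.

Definition energy (M : nat) (s : nat -> C) : R := sumR M (fun k => Cmod (s k) ^ 2).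

(* One section of a lossless lattice filter, on coefficient sequences:
   [S(z) <- w z (c S(z) - s V(z))] and [V(z) <- s S(z) + c V(z)]. *)
Definition lattice_S (c s : R) (w : C) (S V : nat -> C) (k : nat) : C :=
  match k with
  | O => 0%C
  | Datatypes.S k' => (w * (RtoC c * S k' - RtoC s * V k'))%C
  end.

Definition lattice_V (c s : R) (S V : nat -> C) (k : nat) : C :=
  (RtoC s * S k + RtoC c * V k)%C.

Lemma lattice_V_zero (c s : R) (S V : nat -> C) (k : nat) :
  S k = 0%C -> V k = 0%C -> lattice_V c s S V k = 0%C.
Proof. intros HS HV; unfold lattice_V; rewrite HS, HV; ring. Qed.

(** Coefficient by coefficient, a section is a plane rotation, which preserves the sum of squared
    moduli; the unimodular factor and the delay on the first channel do not change moduli. The delay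
    fills slot 0 with zero, and the vanishing of both inputs at [M] keeps the new slot of the second
    channel empty. *)
Lemma lattice_energy (c s : R) (w : C) (M : nat) (S V : nat -> C) :
  c ^ 2 + s ^ 2 = 1 -> Cmod w = 1 ->
  S M = 0%C -> V M = 0%C ->
  energy (Datatypes.S M) (lattice_S c s w S V) + energy (Datatypes.S M) (lattice_V c s S V)
  = energy M S + energy M V.
Proof.
  intros Hcs Hw HS HV; unfold energy.
  rewrite sumR_shift; simpl lattice_S at 1; rewrite Cmod_0; cbn [sumR].
  rewrite lattice_V_zero by assumption.
  rewrite Cmod_0, <- (sumR_plus M (fun k => Cmod (S k) ^ 2)).
  match goal with |- 0 ^ 2 + ?A + (?B + 0 ^ 2) = _ => transitivity (A + B); [ring|] end.
  rewrite <- sumR_plus; apply sumR_ext; intros k _.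
  unfold lattice_V, lattice_S; rewrite Cmod_mult, Hw, Rmult_1_l, !Cmod_sqr.
  destruct (S k) as [x y], (V k) as [u v]; simpl.
  transitivity ((c ^ 2 + s ^ 2) * (x ^ 2 + y ^ 2 + u ^ 2 + v ^ 2)); [ring|].
  rewrite Hcs; ring.
Qed.

Lemma lattice_S_eval (c s : R) (w : C) (M : nat) (S V : nat -> C) (z : C) :
  peval (Datatypes.S M) (lattice_S c s w S V) z
  = (w * z * (RtoC c * peval M S z - RtoC s * peval M V z))%C.
Proof.
  unfold peval; rewrite csum_shift; simpl lattice_S.
  rewrite (csum_ext M _ (fun k => (w * z * RtoC c) * (S k * Cpow z k)
                                + (- (w * z * RtoC s)) * (V k * Cpow z k))%C)
    by (intros; simpl; ring).
  rewrite csum_plus, !csum_scal; ring.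
Qed.

Lemma lattice_V_eval (c s : R) (M : nat) (S V : nat -> C) (z : C) :
  S M = 0%C -> V M = 0%C ->
  peval (Datatypes.S M) (lattice_V c s S V) z
  = (RtoC s * peval M S z + RtoC c * peval M V z)%C.
Proof.
  intros HS HV; unfold peval; simpl csum.
  rewrite lattice_V_zero by assumption.
  rewrite (csum_ext M _ (fun k => RtoC s * (S k * Cpow z k)
                                + RtoC c * (V k * Cpow z k))%C)
    by (intros; unfold lattice_V; ring).
  rewrite csum_plus, !csum_scal; ring.
Qed.

(* Evaluated at [z], each section with [w z = 1] is the rotation by [phi]. *)
Lemma lattice_cascade (phi : R) (z w : C) (P : C -> Prop) (d : nat) (S0 : nat -> C) (i : nat) :
  Cmod w = 1 -> (w * z = 1)%C ->
  (forall k, (d < k)%nat -> S0 k = 0%C) ->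
  (forall y, P y -> peval (S d) S0 y = 0%C) ->
  exists S V : nat -> C,
    (forall k, (d + i < k)%nat -> S k = 0%C) /\
    (forall k, (d + i <= k)%nat -> V k = 0%C) /\
    Cmod (S (d + i)%nat) = Rabs (cos phi) ^ i * Cmod (S0 d) /\
    energy (Datatypes.S (d + i)) S + energy (Datatypes.S (d + i)) V = energy (Datatypes.S d) S0 /\
    (forall y, P y -> peval (Datatypes.S (d + i)) S y = 0%C /\
                      peval (Datatypes.S (d + i)) V y = 0%C) /\
    peval (Datatypes.S (d + i)) S z = (RtoC (cos (INR i * phi)) * peval (Datatypes.S d) S0 z)%C /\
    peval (Datatypes.S (d + i)) V z = (RtoC (sin (INR i * phi)) * peval (Datatypes.S d) S0 z)%C.
Proof.
  intros Hw Hwz Hsupp HP.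
  induction i as [|i (S & V & HS & HV & Hl & HE & HZ & HeS & HeV)].
  (* The second channel starts at zero: this is the reset between nodes. *)
  - exists S0, (fun _ => 0%C).
    assert (Hz : forall y, peval (S d) (fun _ => 0%C) y = 0%C).
    { intros y; unfold peval; transitivity (csum (S d) (fun _ => 0%C)).
      - apply csum_ext; intros; ring.
      - apply csum_zero. }
    rewrite Nat.add_0_r; repeat split; auto.
    + simpl; ring.
    + assert (energy (S d) (fun _ => 0%C) = 0); [|lra].
      unfold energy; generalize (S d); intros m; induction m as [|m IH]; cbn [sumR];
        [reflexivity | rewrite IH, Cmod_0; ring].
    + rewrite Rmult_0_l, cos_0; ring.
    + rewrite Hz; simpl INR; rewrite Rmult_0_l, sin_0; ring.
  - assert (Hcs : cos phi ^ 2 + sin phi ^ 2 = 1)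
      by (generalize (sin2_cos2 phi); unfold Rsqr; intros; nra).
    assert (HS' : S (Datatypes.S (d + i)) = 0%C) by (apply HS; lia).
    assert (HV' : V (Datatypes.S (d + i)) = 0%C) by (apply HV; lia).
    exists (lattice_S (cos phi) (sin phi) w S V), (lattice_V (cos phi) (sin phi) S V).
    rewrite Nat.add_succ_r.
    repeat split.
    + intros [|k] Hk; [lia|]; simpl; rewrite HS, HV by lia; ring.
    + intros k Hk; unfold lattice_V; rewrite HS, HV by lia; ring.
    (* [V] has degree below [d + i], so the top coefficient of [S] is only multiplied by
       [w * cos phi]. *)
    + simpl lattice_S; rewrite (HV (d + i)%nat) by lia.
      rewrite Cmult_0_r; unfold Cminus; rewrite Copp_0, Cplus_0_r.
      rewrite !Cmod_mult, Hw, Cmod_R, Hl; simpl; ring.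
    + rewrite lattice_energy by auto; exact HE.
    (* A common zero of both channels survives any section by linearity, so nodes treated earlier
       stay annihilated. *)
    + rewrite lattice_S_eval; destruct (HZ y H) as [-> ->]; ring.
    + rewrite lattice_V_eval by auto; destruct (HZ y H) as [-> ->]; ring.
    + rewrite lattice_S_eval, HeS, HeV, Hwz, S_INR.
      replace ((INR i + 1) * phi) with (INR i * phi + phi) by ring.
      rewrite cos_plus, RtoC_minus, !RtoC_mult; ring.
    + rewrite lattice_V_eval, HeS, HeV, S_INR by auto.
      replace ((INR i + 1) * phi) with (INR i * phi + phi) by ring.
      rewrite sin_plus, RtoC_plus, !RtoC_mult; ring.
Qed.

Lemma energy_nonneg (M : nat) (s : nat -> C) : 0 <= energy M s.
Proof. apply sumR_nonneg; intros; nra. Qed.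

(** Induction on the number of nodes, one block of [N] sections per node, each block fed with the
    first channel left by the previous one. Each block multiplies the modulus of the top coefficient
    by [cos(phi)^N]. Dropping the second channel after a block can only lose energy, hence the
    inequality on [energy]. *)
Lemma annihilator (N n : nat) (z : nat -> C) :
  (1 <= N)%nat -> (forall j, Cmod (z j) = 1) ->
  exists S : nat -> C,
    (forall k, (n * N < k)%nat -> S k = 0%C) /\
    Cmod (S (n * N)%nat) = Rabs (cos (PI / (2 * INR N))) ^ (n * N) /\
    energy (Datatypes.S (n * N)) S <= 1 /\
    (forall j, (j < n)%nat -> peval (Datatypes.S (n * N)) S (z j) = 0%C).
Proof.
  intros HN Hz.
  assert (HN' : 0 < INR N) by (apply lt_0_INR; lia).
  induction n as [|n (S0 & HS & Hl & HE & Hev)].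
  - exists (fun k => match k with O => 1%C | _ => 0%C end).
    repeat split; simpl; intros; try lia.
    + destruct k; [lia | reflexivity].
    + apply Cmod_1.
    + unfold energy; simpl; rewrite Cmod_1; lra.
  - assert (Hz0 : z n <> 0%C).
    { intros H; generalize (Hz n); rewrite H, Cmod_0; lra. }
    (* The phase [/ z n] turns each section into a real rotation at the new node; the predicate
       collects the nodes already annihilated. *)
    destruct (lattice_cascade (PI / (2 * INR N)) (z n) (/ z n)%C
                (fun y => exists j, (j < n)%nat /\ y = z j) (n * N) S0 N)
      as (S & V & H1 & H2 & H3 & H4 & H5 & H6 & _).
    + rewrite Cmod_inv, Hz by assumption; field.
    + field; exact Hz0.
    + exact HS.
    + intros y (j & Hj & ->); auto.
    + exists S.
      replace (Datatypes.S n * N)%nat with (n * N + N)%nat by lia.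
      repeat split; auto.
      * rewrite H3, Hl, pow_add; ring.
      * generalize (energy_nonneg (Datatypes.S (n * N + N)) V); lra.
      * intros j Hj; destruct (Nat.eq_dec j n) as [->|Hne].
        -- rewrite H6.
           replace (INR N * (PI / (2 * INR N))) with (PI / 2) by (field; lra).
           rewrite cos_PI2; ring.
        -- apply H5; exists j; split; [lia | reflexivity].
Qed.

(** * Exponential sums and their samples on a uniform grid *)

Definition cis (x : R) : C := (cos x, sin x).

Lemma cis_plus (x y : R) : cis (x + y) = (cis x * cis y)%C.
Proof.
  unfold cis, Cmult; simpl; rewrite cos_plus, sin_plus; f_equal; ring.
Qed.

Lemma Cmod_cis (x : R) : Cmod (cis x) = 1.
Proof.
  unfold Cmod, cis; simpl.
  replace (cos x * (cos x * 1) + sin x * (sin x * 1)) with (Rsqr (sin x) + Rsqr (cos x))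
    by (unfold Rsqr; ring).
  rewrite sin2_cos2; apply sqrt_1.
Qed.

Lemma Cpow_cis (x : R) (k : nat) : Cpow (cis x) k = cis (INR k * x).
Proof.
  induction k as [|k IH].
  - simpl; unfold cis; rewrite Rmult_0_l, cos_0, sin_0; reflexivity.
  - cbn [Cpow]; rewrite IH, S_INR, <- cis_plus; f_equal; ring.
Qed.

Definition tp (n : nat) (a : nat -> C) (lam : nat -> R) (t : R) : C :=
  csum n (fun j => a j * cis (lam j * t))%C.

Lemma tp_components (n : nat) (a : nat -> C) (lam : nat -> R) (t : R) :
  tp n a lam t = (tp_re n a lam t, tp_im n a lam t).
Proof.
  unfold tp, tp_re, tp_im; induction n as [|n IH]; [reflexivity|].
  cbn [csum sumR]; rewrite IH; unfold Cplus, Cmult, cis; simpl; f_equal; ring.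
Qed.

Lemma tp_abs_Cmod (n : nat) (a : nat -> C) (lam : nat -> R) (t : R) :
  tp_abs n a lam t = Cmod (tp n a lam t).
Proof. rewrite tp_components; reflexivity. Qed.

Lemma tp_dilate (n : nat) (a : nat -> C) (lam : nat -> R) (x t : R) :
  tp n a (fun j => lam j * x) t = tp n a lam (x * t).
Proof. apply csum_ext; intros; do 2 f_equal; ring. Qed.

(** Reflection negates the frequencies and leaves a phase [cis (lam j)], which the coefficients
    absorb; so the right half of a split interval can be treated like the left. *)
Lemma tp_reflect (n : nat) (a : nat -> C) (lam : nat -> R) (t : R) :
  tp n (fun j => a j * cis (lam j))%C (fun j => - lam j) t = tp n a lam (1 - t).
Proof.
  apply csum_ext; intros j _.
  rewrite <- Cmult_assoc, <- cis_plus; do 2 f_equal; ring.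
Qed.

(** The samples at [k / M] combine powers of the nodes [cis (lam j / M)], so the annihilator of
    these nodes gives a vanishing linear relation between them. Solving it for the last sample and
    applying Cauchy-Schwarz yields the bound. *)
Lemma sampled_endpoint_bound (N n : nat) (a : nat -> C) (lam : nat -> R) :
  (1 <= N)%nat -> (1 <= n)%nat ->
  let M := (n * N)%nat in
  let t := (cos (PI / (2 * INR N)) ^ 2) ^ M in
  t * Cmod (tp n a lam 1) ^ 2
    <= (1 - t) * sumR M (fun k => Cmod (tp n a lam (INR k / INR M)) ^ 2).
Proof.
  intros HN Hn M t.
  assert (HM : 0 < INR M) by (apply lt_0_INR; unfold M; nia).
  destruct (annihilator N n (fun j => cis (lam j / INR M)) HN) as (s & _ & Hl & HE & Hz).
  { intros; apply Cmod_cis. }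
  fold M in Hl, HE, Hz.
  assert (H0 : csum (S M) (fun k => s k * tp n a lam (INR k / INR M))%C = 0%C).
  { transitivity (csum (S M) (fun k =>
        csum n (fun j => a j * (s k * Cpow (cis (lam j / INR M)) k)))%C).
    - apply csum_ext; intros k _; unfold tp; rewrite <- csum_scal.
      apply csum_ext; intros j _; rewrite Cpow_cis.
      replace (lam j * (INR k / INR M)) with (INR k * (lam j / INR M)) by (field; lra).
      ring.
    - rewrite csum_exchange; transitivity (csum n (fun _ => 0%C)); [|apply csum_zero].
      apply csum_ext; intros j Hj; rewrite csum_scal.
      change (a j * peval (S M) s (cis (lam j / INR M)) = 0)%C.
      rewrite Hz by exact Hj; ring. }
  (* The top index samples the sum at the endpoint 1. *)
  cbn [csum] in H0; replace (INR M / INR M) with 1 in H0 by (field; lra).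
  assert (Hmod : Cmod (s M) * Cmod (tp n a lam 1)
    <= sumR M (fun k => Cmod (s k) * Cmod (tp n a lam (INR k / INR M)))).
  { rewrite <- Cmod_mult.
    replace (Cmod (s M * tp n a lam 1)%C)
      with (Cmod (csum M (fun k => s k * tp n a lam (INR k / INR M))%C)).
    - eapply Rle_trans; [apply Cmod_csum_le|].
      right; apply sumR_ext; intros; apply Cmod_mult.
    - rewrite <- Cmod_opp; f_equal.
      assert (Hadd : forall u v : C, (u + v = 0)%C -> (- u = v)%C).
      { intros u v Huv; assert (Hv : v = (u + v - u)%C) by ring.
        rewrite Hv, Huv; ring. }
      apply Hadd, H0. }
  assert (Ht : Cmod (s M) ^ 2 = t).
  { unfold t; rewrite Hl, <- pow_mult, Nat.mul_comm, pow_mult, pow2_abs; reflexivity. }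
  (* The total energy is at most 1 and the top coefficient carries [t] of it. The small remainder
     [1 - t] will compensate for the number [M] of samples. *)
  assert (HEM : energy M s <= 1 - t).
  { unfold energy in HE; cbn [sumR] in HE; rewrite Ht in HE; unfold energy; lra. }
  rewrite <- Ht at 1.
  replace (Cmod (s M) ^ 2 * Cmod (tp n a lam 1) ^ 2)
    with ((Cmod (s M) * Cmod (tp n a lam 1)) ^ 2) by ring.
  eapply Rle_trans.
  { apply pow_incr; split; [|exact Hmod].
    apply Rmult_le_pos; apply Cmod_ge_0. }
  eapply Rle_trans; [apply Cauchy_Schwarz_sumR|].
  apply Rmult_le_compat_r; [|exact HEM].
  apply sumR_nonneg; intros; apply pow2_ge_0.
Qed.

(** * Explicit dependence of the sampled bound on [N] *)

Lemma Bernoulli_sub (M : nat) (x : R) : 0 <= x <= 1 -> 1 - INR M * x <= (1 - x) ^ M.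
Proof.
  intros Hx; induction M as [|M IH]; [simpl; lra|].
  rewrite S_INR; simpl.
  generalize (pos_INR M); intros HM.
  assert (0 <= INR M * x * x) by (repeat apply Rmult_le_pos; lra).
  assert ((1 - x) * (1 - INR M * x) <= (1 - x) * (1 - x) ^ M)
    by (apply Rmult_le_compat_l; lra).
  nra.
Qed.

Lemma sin_sqr_le (x : R) : 0 < x <= PI -> sin x ^ 2 <= x ^ 2.
Proof.
  intros Hx; apply pow_incr; split.
  - apply sin_ge_0; lra.
  - left; apply sin_lt_x; lra.
Qed.

(** With [x = PI / (2 * N)], one has [cos x ^ 2 >= 1 - x ^ 2], and Bernoulli gives
    [t >= 1 - M * x ^ 2]. Lowering [t] to this value weakens both sides of the sampled bound. *)
Lemma mean_square_endpoint_bound (N n : nat) (a : nat -> C) (lam : nat -> R) :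
  (2 <= N)%nat -> (1 <= n)%nat ->
  let M := (n * N)%nat in
  (1 - INR n * PI ^ 2 / 4 / INR N) * Cmod (tp n a lam 1) ^ 2
    <= (PI * INR n / 2) ^ 2
       * (sumR M (fun k => Cmod (tp n a lam (INR k / INR M)) ^ 2) / INR M).
Proof.
  intros HN Hn M.
  assert (HN' : 2 <= INR N) by (apply (le_INR 2); exact HN).
  assert (Hn' : 1 <= INR n) by (apply (le_INR 1); exact Hn).
  assert (HMe : INR M = INR n * INR N) by apply mult_INR.
  pose proof PI_RGT_0 as Hpi. pose proof PI_4 as Hpi4.
  set (x := PI / (2 * INR N)).
  (* [N >= 2] and [PI <= 4] give [x <= 1], which Bernoulli requires of [x ^ 2]. *)
  assert (Hx : 0 < x <= 1).
  { unfold x; split; [apply Rdiv_lt_0_compat; lra|].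
    apply Rmult_le_reg_r with (2 * INR N); [lra|].
    unfold Rdiv; rewrite Rmult_assoc, Rinv_l by lra; lra. }
  assert (Hx2 : 0 <= x ^ 2 <= 1) by nra.
  assert (Hcos : 1 - x ^ 2 <= cos x ^ 2).
  { assert (sin x ^ 2 <= x ^ 2) by (apply sin_sqr_le; generalize PI2_1; lra).
    generalize (sin2_cos2 x); unfold Rsqr; intros; nra. }
  assert (Ht : 1 - INR M * x ^ 2 <= (cos x ^ 2) ^ M).
  { eapply Rle_trans; [apply Bernoulli_sub; exact Hx2 | apply pow_incr; lra]. }
  assert (Hy : INR M * x ^ 2 = INR n * PI ^ 2 / 4 / INR N)
    by (rewrite HMe; unfold x; field; lra).
  assert (HS := sampled_endpoint_bound N n a lam ltac:(lia) Hn).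
  cbv zeta in HS; fold x M in HS.
  rewrite <- Hy.
  (* The constant appears here: [M * x ^ 2] equals [(PI * n / 2) ^ 2 / M], so the sum over samples
     becomes a mean. *)
  replace ((PI * INR n / 2) ^ 2
       * (sumR M (fun k => Cmod (tp n a lam (INR k / INR M)) ^ 2) / INR M))
    with ((INR M * x ^ 2) * sumR M (fun k => Cmod (tp n a lam (INR k / INR M)) ^ 2))
    by (rewrite Hy, HMe; field; split; lra).
  assert (HF := pow2_ge_0 (Cmod (tp n a lam 1))).
  assert (HG : 0 <= sumR M (fun k => Cmod (tp n a lam (INR k / INR M)) ^ 2))
    by (apply sumR_nonneg; intros; apply pow2_ge_0).
  apply Rle_trans with ((cos x ^ 2) ^ M * Cmod (tp n a lam 1) ^ 2).
  { apply Rmult_le_compat_r; assumption. }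
  eapply Rle_trans; [exact HS|].
  apply Rmult_le_compat_r; [assumption | lra].
Qed.

(** * Integrals of continuous functions and left Riemann sums *)

Lemma ex_RInt_cont (g : R -> R) (a b : R) :
  (forall x, continuous g x) -> ex_RInt g a b.
Proof. intros Hg; apply (@ex_RInt_continuous R_CompleteNormedModule); auto. Qed.

Lemma RInt_split (g : R -> R) (a b c : R) :
  (forall x, continuous g x) -> RInt g a b + RInt g b c = RInt g a c.
Proof.
  intros Hg; apply (RInt_Chasles (V := R_CompleteNormedModule) g a b c);
    apply ex_RInt_cont; exact Hg.
Qed.

Lemma left_Riemann_sum_le (g : R -> R) (eps : R) :
  (forall x, continuous g x) -> 0 < eps ->
  exists M0 : nat, forall M, (M0 <= M)%nat -> (1 <= M)%nat ->
    sumR M (fun k => g (INR k / INR M)) / INR M <= RInt g 0 1 + eps.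
Proof.
  intros Hg Heps.
  destruct (@Heine_cor2 g 0 1) with (eps := mkposreal eps Heps) as (delta & Hd).
  { intros x _; apply continuity_pt_filterlim, Hg. }
  destruct (archimed_cor1 delta (cond_pos delta)) as (M0 & HM0 & HM0').
  exists M0; intros M HM HM1.
  assert (HMpos : 0 < INR M) by (apply lt_0_INR; lia).
  assert (HMd : / INR M < delta).
  { eapply Rle_lt_trans; [apply Rinv_le_contravar; [|apply le_INR; exact HM]|exact HM0].
    apply lt_0_INR; exact HM0'. }
  (* Induction over the cells: by uniform continuity [g] stays above its left value minus [eps] on
     each cell, so the error is at most [eps] times the length covered. *)
  assert (H : forall k, (k <= M)%nat ->
    sumR k (fun k => g (INR k / INR M)) / INR M
      <= RInt g 0 (INR k / INR M) + eps * (INR k / INR M)).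
  { induction k as [|k IH]; intros Hk.
    - simpl; unfold Rdiv; rewrite !Rmult_0_l, RInt_point; unfold zero; simpl; lra.
    - specialize (IH ltac:(lia)).
      assert (HkM : INR k + 1 <= INR M) by (rewrite <- S_INR; apply le_INR; exact Hk).
      assert (Hk0 := pos_INR k).
      set (u := INR k / INR M) in *. set (v := INR (S k) / INR M).
      assert (Huv : v = u + / INR M) by (unfold u, v; rewrite S_INR; field; lra).
      assert (Hiv : 0 < / INR M) by (apply Rinv_0_lt_compat; lra).
      assert (Hu0 : 0 <= u) by (unfold u; apply Rmult_le_pos; lra).
      assert (Hv1 : v <= 1).
      { unfold v; rewrite S_INR; apply Rmult_le_reg_r with (INR M); [lra|].
        unfold Rdiv; rewrite Rmult_assoc, Rinv_l by lra; lra. }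
      cbn [sumR]; fold u.
      rewrite <- (RInt_split g 0 u v Hg).
      assert (Hstep : / INR M * (g u - eps) <= RInt g u v).
      { replace (/ INR M * (g u - eps)) with (RInt (fun _ => g u - eps) u v).
        - apply RInt_le; [lra | apply ex_RInt_const | apply ex_RInt_cont; exact Hg |].
          intros x Hx.
          assert (Hux := Hd u x ltac:(lra) ltac:(lra)
                     ltac:(rewrite Rabs_left; lra)); simpl in Hux.
          apply Rabs_def2 in Hux; lra.
        - rewrite RInt_const; unfold scal; simpl; unfold mult; simpl.
          rewrite Huv; ring. }
      rewrite Huv at 2; unfold Rdiv in *; lra. }
  specialize (H M (le_n M)).
  replace (INR M / INR M) with 1 in H by (field; lra); lra.
Qed.

(** * Continuity of the modulus and the limit of large [N] *)

Lemma continuous_tp_re (n : nat) (a : nat -> C) (lam : nat -> R) (x : R) :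
  continuous (tp_re n a lam) x.
Proof.
  unfold tp_re; induction n as [|n IH]; [apply continuous_const|].
  apply (continuous_plus (V := R_NormedModule) _ _ x IH).
  apply (ex_derive_continuous (K := R_AbsRing) (V := R_NormedModule)); auto_derive; trivial.
Qed.

Lemma continuous_tp_im (n : nat) (a : nat -> C) (lam : nat -> R) (x : R) :
  continuous (tp_im n a lam) x.
Proof.
  unfold tp_im; induction n as [|n IH]; [apply continuous_const|].
  apply (continuous_plus (V := R_NormedModule) _ _ x IH).
  apply (ex_derive_continuous (K := R_AbsRing) (V := R_NormedModule)); auto_derive; trivial.
Qed.

Lemma continuous_sqr (g : R -> R) (x : R) :
  continuous g x -> continuous (fun t => g t ^ 2) x.
Proof.
  intros Hg; apply (continuous_comp g (fun y => y ^ 2)); [exact Hg|].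
  apply (ex_derive_continuous (K := R_AbsRing) (V := R_NormedModule)); auto_derive; trivial.
Qed.

Lemma continuous_tp_abs (n : nat) (a : nat -> C) (lam : nat -> R) (x : R) :
  continuous (tp_abs n a lam) x.
Proof.
  unfold tp_abs; apply continuous_sqrt_comp.
  apply (continuous_plus (V := R_NormedModule)); apply continuous_sqr;
    [apply continuous_tp_re | apply continuous_tp_im].
Qed.

(** Let [N] grow in the mean-square bound: the mean of the samples tends to the integral and the
    defect [B / N] tends to zero. Each error gets half of [eps]. *)
Lemma endpoint_bound (n : nat) (a : nat -> C) (lam : nat -> R) :
  (1 <= n)%nat ->
  tp_abs n a lam 1 ^ 2
    <= (PI * INR n / 2) ^ 2 * RInt (fun t => tp_abs n a lam t ^ 2) 0 1.
Proof.
  intros Hn.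
  assert (Hn' : 1 <= INR n) by (apply (le_INR 1); exact Hn).
  pose proof PI_RGT_0 as Hpi.
  set (g := fun t => tp_abs n a lam t ^ 2).
  assert (Hg : forall x, continuous g x)
    by (intros; apply continuous_sqr, continuous_tp_abs).
  set (K := (PI * INR n / 2) ^ 2). change (g 1 <= K * RInt g 0 1).
  assert (HK : 0 < K) by (apply pow_lt; apply Rdiv_lt_0_compat; nra).
  assert (Hg1 : 0 <= g 1) by apply pow2_ge_0.
  set (B := INR n * PI ^ 2 / 4).
  assert (HB : 0 < B) by (unfold B; assert (0 < PI ^ 2) by (apply pow_lt; lra); nra).
  apply le_epsilon; intros eps Heps.
  set (eps1 := eps / (2 * K)).
  assert (He1 : 0 < eps1) by (apply Rdiv_lt_0_compat; lra).
  destruct (left_Riemann_sum_le g eps1 Hg He1) as (M0 & HM0).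
  (* Using [g 1 + 1] keeps the denominator positive even if [g 1 = 0]. *)
  set (eps2 := eps / (2 * B * (g 1 + 1))).
  assert (He2 : 0 < eps2) by (apply Rdiv_lt_0_compat; nra).
  destruct (archimed_cor1 eps2 He2) as (N0 & HN0 & HN0').
  (* The three summands secure [N >= 2], a grid size [n * N >= M0], and [/ N < eps2]. *)
  set (N := (2 + M0 + N0)%nat).
  assert (HNinv : / INR N < eps2).
  { eapply Rle_lt_trans; [apply Rinv_le_contravar|exact HN0].
    - apply lt_0_INR; exact HN0'.
    - apply le_INR; unfold N; lia. }
  assert (HNpos : 0 < / INR N) by (apply Rinv_0_lt_compat, lt_0_INR; unfold N; lia).
  assert (H := mean_square_endpoint_bound N n a lam ltac:(unfold N; lia) Hn).
  cbv zeta in H; rewrite <- tp_abs_Cmod in H.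
  rewrite (sumR_ext _ _ (fun k => g (INR k / INR (n * N)))) in H
    by (intros; unfold g; rewrite tp_abs_Cmod; reflexivity).
  change (tp_abs n a lam 1 ^ 2) with (g 1) in H; fold B K in H.
  specialize (HM0 (n * N)%nat ltac:(unfold N; nia) ltac:(unfold N; nia)).
  assert (HKR : K * (sumR (n * N) (fun k => g (INR k / INR (n * N))) / INR (n * N))
                <= K * (RInt g 0 1 + eps1)) by (apply Rmult_le_compat_l; lra).
  assert (HKe : K * eps1 = eps / 2) by (unfold eps1; field; lra).
  assert (HBe : B / INR N * g 1 <= eps / 2).
  { apply Rle_trans with (B * eps2 * (g 1 + 1)).
    - unfold Rdiv; apply Rmult_le_compat; try nra.
    - right; unfold eps2; field; split; lra. }
  lra.
Qed.

(** * From the endpoint to every point of the interval *)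

(** Dilation by [x] carries the endpoint 1 to [x] and only rescales the frequencies; the
    substitution in the integral supplies the factor [x]. Keeping it on the left avoids dividing
    when [x = 0]. *)
Lemma left_interval_bound (n : nat) (a : nat -> C) (lam : nat -> R) (x : R) :
  (1 <= n)%nat -> 0 <= x ->
  x * tp_abs n a lam x ^ 2
    <= (PI * INR n / 2) ^ 2 * RInt (fun t => tp_abs n a lam t ^ 2) 0 x.
Proof.
  intros Hn Hx.
  assert (H := endpoint_bound n a (fun j => lam j * x) Hn).
  assert (Hd : forall t, tp_abs n a (fun j => lam j * x) t = tp_abs n a lam (x * t))
    by (intros; rewrite !tp_abs_Cmod, tp_dilate; reflexivity).
  rewrite Hd, Rmult_1_r in H.
  set (g := fun t => tp_abs n a lam t ^ 2).
  assert (Hg : forall y, continuous g y)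
    by (intros; apply continuous_sqr, continuous_tp_abs).
  assert (Hscale : RInt g 0 x
    = x * RInt (fun t => tp_abs n a (fun j => lam j * x) t ^ 2) 0 1).
  { rewrite (RInt_ext (fun t => tp_abs n a (fun j => lam j * x) t ^ 2)
                      (fun t => g (x * t + 0)))
      by (intros; unfold g; rewrite Hd, Rplus_0_r; reflexivity).
    assert (Hl := RInt_comp_lin (V := R_CompleteNormedModule) g x 0 0 1
                   (ex_RInt_cont _ _ _ Hg)).
    rewrite (RInt_scal (V := R_CompleteNormedModule) (fun t => g (x * t + 0))) in Hl.
    - replace (x * 0 + 0) with 0 in Hl by ring.
      replace (x * 1 + 0) with x in Hl by ring.
      symmetry; exact Hl.
    - apply ex_RInt_cont; intros y.
      apply (continuous_comp (fun y => x * y + 0) g); [|apply Hg].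
      apply (ex_derive_continuous (K := R_AbsRing) (V := R_NormedModule));
        auto_derive; trivial. }
  rewrite Hscale, <- Rmult_assoc, (Rmult_comm _ x), Rmult_assoc.
  apply Rmult_le_compat_l; assumption.
Qed.

Lemma right_interval_bound (n : nat) (a : nat -> C) (lam : nat -> R) (x : R) :
  (1 <= n)%nat -> x <= 1 ->
  (1 - x) * tp_abs n a lam x ^ 2
    <= (PI * INR n / 2) ^ 2 * RInt (fun t => tp_abs n a lam t ^ 2) x 1.
Proof.
  intros Hn Hx.
  set (b := fun j => (a j * cis (lam j))%C). set (mu := fun j => - lam j).
  assert (H := left_interval_bound n b mu (1 - x) Hn ltac:(lra)).
  assert (Hd : forall t, tp_abs n b mu t = tp_abs n a lam (1 - t))
    by (intros; unfold b, mu; rewrite !tp_abs_Cmod, tp_reflect; reflexivity).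
  rewrite Hd in H; replace (1 - (1 - x)) with x in H by ring.
  eapply Rle_trans; [exact H|]; right; f_equal.
  set (g := fun t => tp_abs n a lam t ^ 2).
  assert (Hg : forall y, continuous g y)
    by (intros; apply continuous_sqr, continuous_tp_abs).
  (* The integrand is put in the form required by the substitution [t -> -1 * t + 1]; the result
     runs from 1 down to [x], and the outer [opp] restores the orientation. *)
  rewrite (RInt_ext (fun t => tp_abs n b mu t ^ 2)
                    (fun t => opp (scal (-1) (g (-1 * t + 1))))).
  - rewrite (RInt_opp (V := R_CompleteNormedModule)
               (fun t => scal (-1) (g (-1 * t + 1)))).
    + rewrite (RInt_comp_lin (V := R_CompleteNormedModule) g (-1) 1)
        by (apply ex_RInt_cont; exact Hg).
      rewrite (opp_RInt_swap (V := R_CompleteNormedModule))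
        by (apply ex_RInt_cont; exact Hg).
      f_equal; ring.
    + apply ex_RInt_cont; intros y.
      apply (continuous_scal_r (V := R_NormedModule) (-1) (fun t => g (-1 * t + 1))).
      apply (continuous_comp (fun y => -1 * y + 1) g); [|apply Hg].
      apply (ex_derive_continuous (K := R_AbsRing) (V := R_NormedModule));
        auto_derive; trivial.
  - intros t _; unfold g, opp, scal; simpl; unfold mult; simpl.
    rewrite Hd; replace (-1 * t + 1) with (1 - t) by ring; ring.
Qed.

(** Add the left and right bounds: the weights [x] and [1 - x] sum to 1 and the two integrals join,
    so splitting costs nothing in the constant. *)
Lemma pointwise_L2_bound (n : nat) (a : nat -> C) (lam : nat -> R) (x : R) :
  (1 <= n)%nat -> 0 <= x <= 1 ->
  tp_abs n a lam x ^ 2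
    <= (PI * INR n / 2) ^ 2 * RInt (fun t => tp_abs n a lam t ^ 2) 0 1.
Proof.
  intros Hn Hx.
  rewrite <- (RInt_split _ 0 x 1)
    by (intros; apply continuous_sqr, continuous_tp_abs).
  assert (H1 := left_interval_bound n a lam x Hn ltac:(lra)).
  assert (H2 := right_interval_bound n a lam x Hn ltac:(lra)).
  lra.
Qed.

(** * The integral, supremum and power used in the norms *)

Lemma integral01_RInt (g : R -> R) :
  (forall x, continuous g x) -> integral01 g = RInt g 0 1.
Proof.
  intros Hg; unfold integral01.
  destruct (ClassicalEpsilon.excluded_middle_informative _) as [H|H].
  - symmetry; apply RInt_Reals.
  - destruct H; constructor; apply ex_RInt_Reals_0, ex_RInt_cont, Hg.
Qed.

Lemma sup01_unique (g : R -> R) (M : R) :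
  is_lub (fun y => exists t, 0 <= t <= 1 /\ y = g t) M -> sup01 g = M.
Proof.
  intros HM; unfold sup01.
  eapply is_lub_u; [|exact HM].
  apply (ClassicalEpsilon.epsilon_spec (inhabits 0)
    (fun M => is_lub (fun y => exists t, 0 <= t <= 1 /\ y = g t) M)).
  exists M; exact HM.
Qed.

Lemma rpow_pos (x y : R) : 0 < x -> rpow x y = Rpower x y.
Proof. intros Hx; unfold rpow; destruct (Rle_dec x 0); [lra | reflexivity]. Qed.

Lemma rpow_nonpos (x y : R) : x <= 0 -> rpow x y = 0.
Proof. intros Hx; unfold rpow; destruct (Rle_dec x 0); [reflexivity | lra]. Qed.

Lemma rpow_nonneg (x y : R) : 0 <= rpow x y.
Proof.
  unfold rpow; destruct (Rle_dec x 0); [lra|]. left; apply exp_pos.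
Qed.

Lemma continuous_rpow (r x : R) : 0 < r -> continuous (fun y => rpow y r) x.
Proof.
  intros Hr; destruct (Rtotal_order x 0) as [Hx|[->|Hx]].
  - apply (continuous_ext_loc _ (fun _ => 0)); [|apply continuous_const].
    exists (mkposreal (- x) ltac:(lra)); intros y Hy.
    apply Rabs_def2 in Hy; unfold minus, plus, opp in Hy; simpl in Hy.
    rewrite rpow_nonpos; lra.
  - apply continuity_pt_filterlim; intros eps Heps.
    (* This radius is the solution of [delta ^ r = eps]; negative arguments have [rpow] equal to
       0. *)
    exists (Rpower eps (1 / r)); split; [apply exp_pos|].
    intros y [_ Hy]; simpl in *; unfold Rdist in *.
    rewrite (rpow_nonpos 0) by lra; rewrite Rminus_0_r in *.
    rewrite Rabs_pos_eq by apply rpow_nonneg.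
    destruct (Rle_or_lt y 0) as [Hy0|Hy0]; [rewrite rpow_nonpos; lra|].
    rewrite rpow_pos by exact Hy0; rewrite Rabs_pos_eq in Hy by lra.
    replace eps with (Rpower (Rpower eps (1 / r)) r).
    + apply Rlt_Rpower_l; lra.
    + rewrite Rpower_mult; replace (1 / r * r) with 1 by (field; lra).
      apply Rpower_1; exact Heps.
  - apply (continuous_ext_loc _ (fun y => Rpower y r)).
    + exists (mkposreal x Hx); intros y Hy.
      apply Rabs_def2 in Hy; unfold minus, plus, opp in Hy; simpl in Hy.
      symmetry; apply rpow_pos; lra.
    + apply (ex_derive_continuous (K := R_AbsRing) (V := R_NormedModule)).
      unfold Rpower; auto_derive; exact Hx.
Qed.

(** * Interpolation between the [L_q] norm and the supremum *)

Lemma Rpower_interp_le (g M q r : R) :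
  0 <= g <= M -> 0 < M -> q <= r -> rpow g r <= Rpower M (r - q) * rpow g q.
Proof.
  intros Hg HM Hqr; destruct (Rle_lt_or_eq_dec 0 g ltac:(lra)) as [H|<-].
  - rewrite !rpow_pos by exact H.
    replace r with ((r - q) + q) at 1 by ring; rewrite Rpower_plus.
    apply Rmult_le_compat_r; [left; apply exp_pos | apply Rle_Rpower_l; lra].
  - rewrite !rpow_nonpos by lra; lra.
Qed.

Lemma RInt_rpow_interp_le (g : R -> R) (M q r : R) :
  (forall x, continuous g x) -> (forall t, 0 <= t <= 1 -> 0 <= g t <= M) ->
  0 < M -> 0 < q <= r ->
  RInt (fun t => rpow (g t) r) 0 1
    <= Rpower M (r - q) * RInt (fun t => rpow (g t) q) 0 1.
Proof.
  intros Hg HgM HM Hqr.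
  assert (Hc : forall s, 0 < s -> forall x, continuous (fun t => rpow (g t) s) x)
    by (intros s Hs x; apply (continuous_comp g (fun y => rpow y s));
        [apply Hg | apply continuous_rpow, Hs]).
  rewrite <- (RInt_scal (V := R_CompleteNormedModule))
    by (apply ex_RInt_cont, Hc; lra).
  apply RInt_le; [lra | apply ex_RInt_cont, Hc; lra | |].
  - apply ex_RInt_cont; intros x.
    apply (continuous_scal_r (V := R_NormedModule)), Hc; lra.
  - intros t Ht; apply Rpower_interp_le; [apply HgM; lra | lra | lra].
Qed.

Lemma rpow_2 (x : R) : 0 <= x -> rpow x 2 = x ^ 2.
Proof.
  intros Hx; destruct (Rle_lt_or_eq_dec 0 x Hx) as [H|<-].
  - rewrite rpow_pos by exact H; apply (Rpower_pow 2 x H).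
  - rewrite rpow_nonpos by lra; ring.
Qed.

(** With [M] the maximum of [g] on the unit interval, [M^2 <= K^2 * int g^2 <= K^2 * M^(2-q) * int
    g^q], where [q <= 2] enters. Cancelling [M^(2-q)] settles the supremum norm; a finite [p]
    follows from [int g^p <= M^(p-q) * int g^q]. *)
Lemma nikolskii_of_L2_bound (g : R -> R) (K q : R) (p : exponent) :
  (forall x, continuous g x) -> (forall t, 0 <= g t) -> 0 < K ->
  (forall x, 0 <= x <= 1 -> g x ^ 2 <= K ^ 2 * RInt (fun t => g t ^ 2) 0 1) ->
  0 < q <= 2 -> exp_gt p q ->
  Lnorm p g <= Rpower K (2 / q - 2 * inv_exp p) * Lnorm (Fin q) g.
Proof.
  intros Hg Hg0 HK H2 Hq Hp.
  destruct (continuity_ab_maj g 0 1) as (x0 & Hmax & Hx0); [lra | |].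
  { intros; apply continuity_pt_filterlim, Hg. }
  set (M := g x0) in *.
  assert (Hc : forall s, 0 < s -> forall x, continuous (fun t => rpow (g t) s) x)
    by (intros s Hs x; apply (continuous_comp g (fun y => rpow y s));
        [apply Hg | apply continuous_rpow, Hs]).
  assert (Hsup : sup01 g = M).
  { apply sup01_unique; split.
    - intros y (t & Ht & ->); apply Hmax, Ht.
    - intros b Hb; apply Hb; exists x0; auto. }
  assert (Hrhs : 0 <= Rpower K (2 / q - 2 * inv_exp p) * Lnorm (Fin q) g).
  { apply Rmult_le_pos; [left; apply exp_pos | apply rpow_nonneg]. }
  assert (HM0 : 0 <= M) by apply Hg0.
  (* Cancelling a power of [M] requires [M > 0]; [M = 0] is handled apart. *)
  destruct (Rle_lt_or_eq_dec 0 M HM0) as [HM|HM].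
  - set (Iq := RInt (fun t => rpow (g t) q) 0 1).
    assert (HMq : Rpower M q <= Rpower K 2 * Iq).
    { assert (H := RInt_rpow_interp_le g M q 2 Hg
                     ltac:(intros; split; auto) HM ltac:(lra)).
      rewrite (RInt_ext (fun t => rpow (g t) 2) (fun t => g t ^ 2)) in H
        by (intros; apply rpow_2, Hg0).
      specialize (H2 x0 Hx0); fold M in H2; fold Iq in H.
      assert (Hk2 : Rpower K 2 = K ^ 2) by (apply (Rpower_pow 2 K HK)).
      assert (Hm2 : M ^ 2 = Rpower M (2 - q) * Rpower M q).
      { rewrite <- Rpower_plus; replace (2 - q + q) with (INR 2) by (simpl; ring).
        symmetry; apply (Rpower_pow 2 M HM). }
      apply Rmult_le_reg_l with (Rpower M (2 - q)); [apply exp_pos|].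
      rewrite <- Hm2, Hk2.
      eapply Rle_trans; [exact H2|].
      replace (Rpower M (2 - q) * (K ^ 2 * Iq)) with (K ^ 2 * (Rpower M (2 - q) * Iq))
        by ring.
      apply Rmult_le_compat_l; [apply pow2_ge_0 | exact H]. }
    assert (HIq : 0 < Iq).
    { assert (0 < Rpower M q) by apply exp_pos.
      assert (0 < Rpower K 2) by apply exp_pos.
      destruct (Rle_or_lt Iq 0); [nra | assumption]. }
    assert (HMK : M <= Rpower K (2 / q) * Rpower Iq (1 / q)).
    { replace (Rpower K (2 / q)) with (Rpower (Rpower K 2) (1 / q))
        by (rewrite Rpower_mult; f_equal; field; lra).
      rewrite Rpower_mult_distr by (assumption || apply exp_pos).
      replace M with (Rpower (Rpower M q) (1 / q)).
      - apply Rle_Rpower_l; [|split; [apply exp_pos | exact HMq]].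
        left; apply Rdiv_lt_0_compat; lra.
      - rewrite Rpower_mult; replace (q * (1 / q)) with 1 by (field; lra).
        apply Rpower_1, HM. }
    assert (HLq : Lnorm (Fin q) g = Rpower Iq (1 / q)).
    { unfold Lnorm; rewrite integral01_RInt by (apply Hc; lra).
      fold Iq; apply rpow_pos, HIq. }
    rewrite HLq.
    destruct p as [r|]; simpl in Hp |- *.
    + rewrite integral01_RInt by (apply Hc; lra).
      assert (HI := RInt_rpow_interp_le g M q r Hg
                      ltac:(intros; split; auto) HM ltac:(lra)).
      fold Iq in HI.
      set (Ir := RInt (fun t => rpow (g t) r) 0 1) in *.
      destruct (Rle_or_lt Ir 0) as [HIr|HIr].
      { rewrite rpow_nonpos by exact HIr; left; apply Rmult_lt_0_compat; apply exp_pos. }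
      rewrite rpow_pos by exact HIr.
      set (A := Rpower K (2 / q)) in *. set (B := Rpower Iq (1 / q)) in *.
      assert (HA : 0 < A) by apply exp_pos. assert (HB : 0 < B) by apply exp_pos.
      assert (HBq : Iq = Rpower B q).
      { unfold B; rewrite Rpower_mult; replace (1 / q * q) with 1 by (field; lra).
        symmetry; apply Rpower_1, HIq. }
      (* [A * B] bounds [M] and [Rpower B q] is [Iq]. After the root, [K] has exponent
         [(2 / q) * (r - q) / r = 2 / q - 2 / r] and [B] has exponent [(r - q + q) / r = 1]. *)
      replace (Rpower K (2 / q - 2 * (1 / r)) * B)
        with (Rpower (Rpower (A * B) (r - q) * Rpower B q) (1 / r)).
      * apply Rle_Rpower_l; [left; apply Rdiv_lt_0_compat; lra|].
        split; [exact HIr|]; rewrite <- HBq.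
        eapply Rle_trans; [exact HI|].
        apply Rmult_le_compat_r; [lra|]; apply Rle_Rpower_l; lra.
      * rewrite <- (Rpower_mult_distr A B), Rmult_assoc, <- Rpower_plus by assumption.
        rewrite <- Rpower_mult_distr, !Rpower_mult by apply exp_pos.
        unfold A; rewrite Rpower_mult.
        replace ((r - q + q) * (1 / r)) with 1 by (field; lra).
        rewrite Rpower_1 by exact HB.
        do 2 f_equal; field; lra.
    + rewrite Hsup; replace (2 / q - 2 * 0) with (2 / q) by ring; exact HMK.
  (* Here [g] vanishes on the whole unit interval, so the left-hand norm is 0. *)
  - eapply Rle_trans; [right | exact Hrhs].
    destruct p as [r|]; simpl in Hp |- *; [|rewrite Hsup; auto].
    rewrite integral01_RInt by (apply Hc; lra).
    apply rpow_nonpos; right.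
    rewrite (RInt_ext _ (fun _ => 0)).
    + rewrite RInt_const; unfold scal; simpl; unfold mult; simpl; ring.
    + intros x Hx; rewrite Rmin_left, Rmax_right in Hx by lra.
      apply rpow_nonpos; rewrite HM; apply Hmax; lra.
Qed.

Theorem theorem2p5 :
  forall (q : R) (p : exponent),
    0 < q -> q <= 2 -> exp_gt p q ->
    forall (n : nat) (a : nat -> Cx) (lam : nat -> R),
      (1 <= n)%nat ->
      strictly_increasing_upto n lam ->
      Lnorm p (tp_abs n a lam)
        <= Rpower (PI * INR n / 2) (2 / q - 2 * inv_exp p)
           * Lnorm (Fin q) (tp_abs n a lam).
Proof.
  intros q p Hq0 Hq2 Hp n a lam Hn _.
  apply nikolskii_of_L2_bound; auto.
  - apply continuous_tp_abs.
  - intros; apply sqrt_pos.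
  - generalize PI_RGT_0 (lt_0_INR n ltac:(lia)); intros; nra.
  - intros; apply pointwise_L2_bound; assumption.
Qed.
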